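(* For any online algorithm $\mathrm{ALG}$ for SPVT (given for each number $n$ of buyers) and any $\delta>0$, there exists $n_0$ such that for all $n\ge n_0$ there exists a buyer price vector $\boldsymbol X'=(X'_1,\dots,X'_n)\in\mathbb N^n$ with $X'_1>\dots>X'_n$ such that, when the seller's price is $0$, $$\frac{\mathrm{OPT}(\boldsymbol X')}{\mathrm{ALG}(\boldsymbol X')}\ge \frac{4e^2}{e^2+1}-\delta,$$ where $\mathrm{OPT}(\boldsymbol X')=X'_1$ is the strong offline optimum (and the ratio is $+\infty$ if $\mathrm{ALG}(\boldsymbol X')=0$).
   Context: SPVT (secretary problem variant trading): there are $n$ buyers with non-negative prices and one seller with a non-negative price (together: $n+1$ agents). The seller initially holds one item; the intermediary and the buyers hold none. The agents arrive one by one in a uniformly random order; on arrival an agent reveals its price and whether it is a buyer or the seller. On each arrival the intermediary must immediately and irrevocably decide whether to trade: it may buy the item from the seller when the seller arrives, and it may sell the item to an arriving buyer only if it currently holds it. The social welfare is the price of the agent finally holding the item ($0$ if the intermediary ends up with it). An online algorithm is a (possibly randomized) rule which, knowing $n$ but not the prices or the order in advance, makes each decision based only on what has been revealed so far. Here the seller's price is fixed to $0$, so an instance is given by the buyer price vector $\boldsymbol X=(X_1,\dots,X_n)$, with buyers labelled so that $X_1>\dots>X_n$. $\mathrm{ALG}(\boldsymbol X)$ is the expected social welfare achieved by the algorithm (over the random order and the algorithm's randomness). The strong offline optimum is the highest price among all $n+1$ agents, i.e. $X_1$. *)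

(* Defs.v *)
From HB Require Import structures.
From mathcomp Require Import all_boot all_order all_algebra all_fingroup.
From mathcomp Require Import all_classical all_reals all_analysis.

Set Implicit Arguments.
Unset Strict Implicit.
Unset Printing Implicit Defensive.

Import Order.TTheory GRing.Theory Num.Theory.

Local Open Scope classical_set_scope.
Local Open Scope ring_scope.

(* The n + 1 agents are the elements of 'I_n.+1: agent ord0 is the seller and
   agent lift ord0 i is the buyer i : 'I_n, so that agent number k > 0 is the
   k-th buyer in the 1-based numbering X_1, ..., X_n. *)
Definition prices (R : realType) (n : nat) (x0 : R) (X : 'I_n -> R)
    (a : 'I_n.+1) : R :=
  if unlift ord0 a is Some i then X i else x0.

(* (true, x): the seller arrives with price x; (false, x): a buyer does.
   The identity of the buyer is not revealed. *)
Definition observation (R : realType) : Type := (bool * R)%type.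

Definition reveal (R : realType) (n : nat) (p : 'I_n.+1 -> R) (a : 'I_n.+1)
    : observation R :=
  (a == ord0, p a).

(* An arrival order is s : 'S_n.+1, where s t is the agent arriving at time t.
   The history at time t includes the arrival at time t itself. *)
Definition history (R : realType) (n : nat) (p : 'I_n.+1 -> R) (s : 'S_n.+1)
    (t : 'I_n.+1) : seq (observation R) :=
  [seq reveal p (s u) | u : 'I_n.+1 <- enum 'I_n.+1 & (u <= t)%N].

(* [Some a]: agent a holds the item; [None]: the intermediary holds it.
   A decision to trade that is not feasible has no effect. *)
Definition step (n : nat) (trade : bool) (h : option 'I_n.+1) (a : 'I_n.+1)
    : option 'I_n.+1 :=
  if ~~ trade then h
  else if (a == ord0) && (h == Some ord0) then None
  else if (a != ord0) && (h == None) then Some a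
  else h.

Definition final_holder (R : realType) (n : nat)
    (rule : seq (observation R) -> bool) (p : 'I_n.+1 -> R) (s : 'S_n.+1)
    : option 'I_n.+1 :=
  foldl (fun h t => step (rule (history p s t)) h (s t))
        (Some ord0) (enum 'I_n.+1).

Definition welfare (R : realType) (n : nat)
    (rule : seq (observation R) -> bool) (p : 'I_n.+1 -> R) (s : 'S_n.+1) : R :=
  if final_holder rule p s is Some a then p a else 0.

(* A randomized online algorithm draws a seed from an arbitrary probability
   space and then decides deterministically from the seed and the history.
   Its own earlier decisions are functions of the seed and of prefixes of the
   history, so they need not be given to the rule. *)
Record online_algorithm (R : realType) : Type := OnlineAlgorithm {
  seed_display : measure_display;
  seed : measurableType seed_display;
  seed_law : probability seed R;
  decide : seed -> seq (observation R) -> bool;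
  measurable_decide : forall h : seq (observation R),
    measurable [set w : seed | decide w h]
}.

Definition ALG (R : realType) (n : nat) (A : online_algorithm R)
    (p : 'I_n.+1 -> R) : \bar R :=
  expectation (seed_law A) (fun w : seed A =>
    (\sum_(s : 'S_n.+1) welfare (decide w) p s) / (n.+1)`!%:R).

Definition OPT (R : realType) (n : nat) (p : 'I_n.+1 -> R) : R :=
  \big[Num.max/p ord0]_(a < n.+1) p a.

(* Main.v *)
Require Import Defs.
From HB Require Import structures.
From mathcomp Require Import all_boot all_order all_algebra all_fingroup.
From mathcomp Require Import all_classical all_reals all_analysis.
From mathcomp Require Import measurable_realfun.
From mathcomp Require Import ring lra zify.

(* By averaging, it suffices to exhibit a random price vector that is hard for
   every deterministic rule.  Prices are B ^ y_i with B huge, so that only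
   selling to the best buyer matters.  An ordered list of n distinct values y
   in {1, ..., N} gets the weight 1 / (m (m-1) ... (m-n+1)), m being the largest
   value.  For N = oo these weights are exactly consistent: the marginal weight
   of a prefix of length i with maximum m is proportional to the inverse of the
   falling factorial m ^_ i, so that whether the next value is a record is
   independent of the values seen so far, and observing values is no better
   than observing relative ranks.  The total weight diverges logarithmically, and
   truncating at N costs a factor that tends to 1.

   When the seller arrives after j buyers, backward induction bounds the weight
   of winning by Q 0 times the harmonic sum of N, for every Q that satisfies the
   optimality inequalities of the secretary problem in which the first j buyers
   are skipped; Q comes from the usual threshold k ~ n / e.  Averaging over j
   gives the discrete analogue of
     1/e * 1/e + \int_(1/e)^1 (- x ln x) dx = 1/4 + 1/(4 e^2). *)

Set Implicit Arguments.
Unset Strict Implicit.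
Unset Printing Implicit Defensive.

Import Order.TTheory GRing.Theory Num.Theory.

Local Open Scope ring_scope.

(** * Weighted lists of distinct values *)

(* The element x of 'I_N stands for the positive integer x + 1, and [top] is the
   largest of the integers listed. *)
Definition top (N : nat) (u : seq 'I_N) : nat := (\max_(x <- u) x.+1)%N.

Lemma top_cat (N : nat) (u t : seq 'I_N) : top (u ++ t) = maxn (top u) (top t).
Proof. by rewrite /top big_cat. Qed.

Lemma top_rcons (N : nat) (u : seq 'I_N) x : top (rcons u x) = maxn (top u) x.+1.
Proof. by rewrite -cats1 top_cat {2}/top big_seq1. Qed.

Lemma leq_top (N : nat) (u : seq 'I_N) x : x \in u -> (x < top u)%N.
Proof.
rewrite /top; elim: u => // y u IH; rewrite inE big_cons leq_max.
by case/orP => [/eqP ->|/IH ->]; rewrite ?leqnn ?orbT.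
Qed.

Lemma top_bound (N : nat) (u : seq 'I_N) : (top u <= N)%N.
Proof. by rewrite /top; apply/bigmax_leqP_seq => x _ _. Qed.

Lemma card_fresh_below (N : nat) (u : seq 'I_N) : uniq u ->
  #|[pred x : 'I_N | (x \notin u) && (x < top u)%N]| = (top u - size u)%N.
Proof.
move=> uu.
have -> : (top u - size u = #|[pred x : 'I_N | (x < top u)%N]| - #|u|)%N.
  rewrite (card_uniqP uu) -sum1_card /=; congr subn.
  rewrite (eq_bigl (fun x : 'I_N => (x < top u)%N)) //.
  by rewrite (big_ord_narrow (top_bound u)) /= sum1_card card_ord.
rewrite -(@cardID _ (mem u) [pred x : 'I_N | (x < top u)%N]).
have -> : #|[predI [pred x : 'I_N | (x < top u)%N] & mem u]| = #|u|.
  by apply: eq_card => x; rewrite !inE andbC; case: (boolP (x \in u)) => // /leq_top ->.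
rewrite addKn; by apply: eq_card => x; rewrite !inE.
Qed.

Lemma size_le_top (N : nat) (u : seq 'I_N) : uniq u -> (size u <= top u)%N.
Proof.
move=> uu; rewrite -(size_map val).
have uv : uniq (map val u) by rewrite map_inj_uniq //; exact: val_inj.
have := uniq_leq_size uv (s2 := iota 0 (top u)) _.
rewrite size_iota; apply => x /mapP[y yu ->].
by rewrite mem_iota /= add0n leq_top.
Qed.

Lemma ffactnD (m i k : nat) : (m ^_ (i + k) = m ^_ i * (m - i) ^_ k)%N.
Proof.
elim: k => [|k IH]; first by rewrite addn0 ffactn0 muln1.
by rewrite addnS !ffactnSr IH mulnA subnDA.
Qed.

Section big_tuple.
Variables (R : Type) (idx : R) (op : Monoid.com_law idx) (T : finType).

Lemma big_tuple_cons (k : nat) (F : k.+1.-tuple T -> R) :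
  \big[op/idx]_(t : k.+1.-tuple T) F t =
  \big[op/idx]_(x : T) \big[op/idx]_(t : k.-tuple T) F [tuple of x :: t].
Proof.
rewrite pair_big /=.
rewrite (reindex (fun z : T * k.-tuple T => [tuple of z.1 :: z.2])) //=.
exists (fun t : k.+1.-tuple T => (thead t, [tuple of behead t])) => [[x t]|t] _ /=.
  by congr pair; apply/val_inj.
by rewrite -tuple_eta.
Qed.

End big_tuple.

Section tuple_sums.
Variables (R : realType) (N : nat).
Implicit Types u t v : seq 'I_N.

Lemma sum_tuple_rcons (F : seq 'I_N -> R) k u :
  \sum_(t : k.+1.-tuple 'I_N) F (u ++ t) =
  \sum_(x : 'I_N) \sum_(t : k.-tuple 'I_N) F (rcons u x ++ t).
Proof.
rewrite big_tuple_cons; apply: eq_bigr => x _; apply: eq_bigr => t _ /=.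
by rewrite cat_rcons.
Qed.

Lemma sum_tuple0 (F : seq 'I_N -> R) u :
  \sum_(t : 0.-tuple 'I_N) F (u ++ t) = F u.
Proof.
rewrite (bigD1 [tuple]) //= cats0 big1 ?addr0 // => t /negP[].
by rewrite (tuple0 t).
Qed.

(** Each further value is one of the [top u - size u] fresh ones below the maximum, and choosing it
    uses up one of them. *)
Lemma sum_top_stable k u : uniq u ->
  \sum_(t : k.-tuple 'I_N) (uniq (u ++ t) && (top (u ++ t) == top u))%:R
  = ((top u - size u) ^_ k)%:R :> R.
Proof.
elim: k u => [|k IH] u uu.
  rewrite (sum_tuple0 (fun v => (uniq v && (top v == top u))%:R)).
  by rewrite uu eqxx ffactn0.
rewrite (sum_tuple_rcons (fun v => (uniq v && (top v == top u))%:R)).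
rewrite (bigID [pred x : 'I_N | (x \notin u) && (x < top u)%N]) /=.
rewrite [X in _ + X]big1 ?addr0; last first.
  move=> x; rewrite negb_and negbK => H; apply: big1 => t _.
  case: (boolP (x \in u)) => [xu|xu].
    by rewrite cat_uniq rcons_uniq xu.
  move: H; rewrite (negPf xu) /= -leqNgt => H.
  rewrite top_cat top_rcons gtn_eqF ?andbF //.
  by rewrite !leq_max ltnS H orbT.
under eq_bigr => x /andP[xu xt].
  have Htop : top (rcons u x) = top u by rewrite top_rcons; apply/maxn_idPl.
  rewrite -{1}Htop IH ?rcons_uniq ?xu // Htop size_rcons; over.
by rewrite sumr_const card_fresh_below // -mulrnA ffactnS subnS mulnC.
Qed.

(** The denominator counts the lists of [size v] distinct integers between 1 and [top v]; it is
    nonzero when [v] is [uniq], as then [size v <= top v]. *)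
Definition weight v : R := (uniq v)%:R / (top v ^_ size v)%:R.

Lemma weight_ge0 v : 0 <= weight v.
Proof. by rewrite /weight divr_ge0. Qed.

Lemma sum_weight_top_stable k u : uniq u ->
  \sum_(t : k.-tuple 'I_N) weight (u ++ t) * (top (u ++ t) == top u)%:R
  = ((top u - size u) ^_ k)%:R / (top u ^_ (size u + k))%:R.
Proof.
move=> uu; rewrite -sum_top_stable // mulr_suml; apply: eq_bigr => t _.
rewrite /weight size_cat size_tuple.
by case: eqP => [->|_]; rewrite ?andbT ?andbF ?mulr1 ?mulr0 ?mul0r.
Qed.

(** By [ffactnD] the two sides agree, unless fewer than [k] fresh values remain below the maximum;
    then the sum is 0. *)
Lemma sum_weight_top_stable_le k u : uniq u ->
  \sum_(t : k.-tuple 'I_N) weight (u ++ t) * (top (u ++ t) == top u)%:R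
  <= ((top u ^_ size u)%:R)^-1.
Proof.
move=> uu; rewrite sum_weight_top_stable // ffactnD natrM invfM mulrCA.
rewrite ler_piMr ?invr_ge0 ?ler0n //.
by have [->|/mulfV ->] := eqVneq (((top u - size u) ^_ k)%:R : R) 0; rewrite ?mul0r.
Qed.

End tuple_sums.

(** * Backward induction *)

Lemma top_attained (N : nat) (u : seq 'I_N) : (0 < size u)%N ->
  exists2 x, x \in u & top u = x.+1.
Proof.
elim: u => // y u IH _; case: (posnP (size u)) => [/size0nil ->|/IH[x xu E]].
  by exists y; rewrite ?inE // /top big_seq1.
rewrite -cat1s top_cat E /top big_seq1.
case: (leqP x y) => H; [exists y|exists x]; rewrite ?inE ?eqxx ?xu ?orbT //; lia.
Qed.

Section stopping.
Variables (R : realType) (N : nat).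
Implicit Types u t v : seq 'I_N.

(* [e] tells whether to stop at a prefix; [u] has been seen, [t] is to come. *)
Fixpoint stops_on_top (e : seq 'I_N -> bool) u t : bool :=
  if t is x :: t' then
    if e (rcons u x) then top (u ++ t) == x.+1
    else stops_on_top e (rcons u x) t'
  else false.

(** A telescoping sum: [1 / (x+1)^_(i+1)] is [1/i] times the difference of [1 / x^_i] and
    [1 / (x+1)^_i]. *)
Lemma sum_inv_ffact (m i : nat) : (0 < i)%N -> (i <= m)%N -> (m <= N)%N ->
  \sum_(x < N) (if (m <= x)%N then ((x.+1 ^_ i.+1)%:R)^-1 else 0 : R)
  = i%:R^-1 * ((m ^_ i)%:R^-1 - (N ^_ i)%:R^-1).
Proof.
move=> i0 im; elim: N => [|M IH] mM; first by lia.
rewrite big_ord_recr /=; move: mM; rewrite leq_eqVlt => /orP[/eqP mM|].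
  rewrite mM ltnn subrr mulr0 addr0 big1 // => x _.
  by rewrite ifF //; apply/negbTE; rewrite -ltnNge ltnS ltnW.
rewrite ltnS => mM; rewrite mM IH //.
have E1 : (M.+1 ^_ i.+1 = M.+1 * M ^_ i)%N by rewrite ffactSS.
have E2 : (M.+1 ^_ i.+1 = M.+1 ^_ i * (M.+1 - i))%N by rewrite ffactnSr.
have p1 : (M ^_ i)%:R != 0 :> R by rewrite pnatr_eq0 -lt0n ffact_gt0 (leq_trans im).
have p2 : (M.+1 ^_ i)%:R != 0 :> R.
  by rewrite pnatr_eq0 -lt0n ffact_gt0 (leq_trans im) // ltnW.
have p7 : (m ^_ i)%:R != 0 :> R by rewrite pnatr_eq0 -lt0n ffact_gt0.
have p3 : i%:R != 0 :> R by rewrite pnatr_eq0 -lt0n.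
have p4 : M.+1%:R != 0 :> R by rewrite pnatr_eq0.
have p5 : (M.+1 ^_ i)%:R * (M.+1%:R - i%:R) = M.+1%:R * (M ^_ i)%:R :> R.
  by rewrite -natrB ?(leq_trans im) ?leqW // -!natrM -E1 -E2.
rewrite E1 natrM.
have p6 : M.+1%:R - i%:R != 0 :> R.
  by rewrite -natrB ?(leq_trans im) ?leqW // pnatr_eq0 -lt0n; lia.
have -> : (M ^_ i)%:R = (M.+1 ^_ i)%:R * (M.+1%:R - i%:R) / M.+1%:R :> R.
  by rewrite p5 mulrC mulKf.
by field; rewrite p2 p7 p3 nat1r p4 p6.
Qed.

Section dynamic_programming.
Variables (n : nat) (Q : nat -> R) (e : seq 'I_N -> bool).
Hypothesis Q_ge0 : forall i, 0 <= Q i.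
Hypothesis Q_noninc : forall i, (i < n)%N -> Q i.+1 <= Q i.
Hypothesis Q_stop : forall u x, (size u < n)%N -> e (rcons u x) ->
  (size u)%:R * Q (size u).+1 + (size u).+1%:R <= (size u).+1%:R * Q (size u).

(** With [i = size u], [m = top u] and no truncation at [N], the extensions of [u] would have total
    weight [n / (i * m ^_ i)], so [Q i / n] stands for a winning probability. The next value is a
    record with probability [1 / (i + 1)], and stopping there wins with probability [(i + 1) / n].
    [Q_stop] and [Q_noninc] cover stopping and continuing at a record. *)
Lemma sum_stops_on_top_le k u : uniq u -> (size u + k = n)%N -> (0 < size u)%N ->
  \sum_(t : k.-tuple 'I_N) weight R (u ++ t) * (stops_on_top e u t)%:R
  <= Q (size u) / ((size u)%:R * (top u ^_ size u)%:R).
Proof.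
elim: k u => [|k IH] u uu su u0.
  rewrite big1 => [|t _]; last by rewrite (tuple0 t) mulr0.
  by rewrite divr_ge0.
set i := size u in su u0 *; set m := top u.
have im : (i <= m)%N by apply: size_le_top.
have ltin : (i < n)%N by lia.
(* [c] solves [i * q + c = (i + 1) * Q i]. It dominates both options at a record: [q <= c] for
   continuing, [i + 1 <= c] for stopping. The majorant [G] charges [q] to fresh values below the
   maximum and [c] to records. *)
pose q := Q i.+1; pose c := i.+1%:R * Q i - i%:R * q.
have q0 : 0 <= q by exact: Q_ge0.
have i1 : 0 < i.+1%:R :> R by rewrite ltr0n.
have ip : 0 < i%:R :> R by rewrite ltr0n.
have qc : q <= c.
  have := Q_noninc ltin; rewrite -/q /c -natr1 => H.
  have := ler_wpM2l (ltW ip) H; lra.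
have c0 : 0 <= c by exact: le_trans qc.
pose G (x : 'I_N) : R :=
  (if (x \notin u) && (x < m)%N then q / (i.+1%:R * (m ^_ i.+1)%:R) else 0)
  + c / i.+1%:R * (if (m <= x)%N then ((x.+1 ^_ i.+1)%:R)^-1 else 0).
rewrite big_tuple_cons.
apply: (@le_trans _ _ (\sum_x G x)).
  apply: ler_sum => x _ /=.
  have G0 : 0 <= G x.
    rewrite /G addr_ge0 //; first by case: ifP => // _; rewrite divr_ge0 ?mulr_ge0.
    by rewrite mulr_ge0 ?divr_ge0 //; case: ifP.
  have [xu|xu] := boolP (x \in u).
    rewrite big1 // => t _; rewrite /weight cat_uniq /= xu /= andbF.
    by rewrite !mul0r.
  have uux : uniq (rcons u x) by rewrite rcons_uniq xu.
  have sux : (size (rcons u x) + k)%N = n by rewrite size_rcons -/i; lia.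
  have sux0 : (0 < size (rcons u x))%N by rewrite size_rcons.
  have [xm|mx] := ltnP x m.
    have tx : top (rcons u x) = m by rewrite top_rcons; apply/maxn_idPl.
    have -> : G x = q / (i.+1%:R * (m ^_ i.+1)%:R).
      by rewrite /G xu xm /= ifF ?mulr0 ?addr0 //; apply/negbTE; rewrite -ltnNge.
    case: (boolP (e _)) => He.
      (* Stopping on a value below the maximum of [u] never wins. *)
      rewrite big1 ?divr_ge0 ?mulr_ge0 // => t _.
      case: eqP => E; rewrite ?mulr0 //.
      have [y yu Ey] := top_attained u0.
      move: E; rewrite top_cat -/m => E.
      suff xy : x = y by rewrite xy yu in xu.
      by apply/val_inj => /=; move: xm; rewrite /m Ey; rewrite /m Ey in E; lia.
    have := IH _ uux sux sux0; rewrite size_rcons tx => /(le_trans _); apply.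
    by apply: ler_sum => t _; rewrite cat_rcons.
  have tx : top (rcons u x) = x.+1.
    by rewrite top_rcons; apply/maxn_idPr; rewrite ltnW.
  have -> : G x = c / (i.+1%:R * (x.+1 ^_ i.+1)%:R).
    by rewrite /G mx ltnNge mx andbF add0r invfM mulrA.
  case: (boolP (e _)) => He.
    have ci : i.+1%:R <= c by rewrite /c lerBrDl; apply: Q_stop He.
    have := sum_weight_top_stable_le R k uux; rewrite tx size_rcons.
    move=> H; apply: (le_trans _ (le_trans H _)).
      by apply: ler_sum => t _; rewrite cat_rcons.
    rewrite invfM mulrA.
    by rewrite ler_peMl ?invr_ge0 // ler_pdivlMr // mul1r.
  have := IH _ uux sux sux0; rewrite size_rcons tx => H.
  apply: (le_trans _ (le_trans H _)).
    by apply: ler_sum => t _; rewrite cat_rcons.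
  by rewrite ler_wpM2r ?invr_ge0 ?mulr_ge0.
rewrite big_split /= -mulr_sumr sum_inv_ffact // ?top_bound //.
rewrite -big_mkcond /= sumr_const card_fresh_below // -/i -/m.
have mi0 : 0 < (m ^_ i)%:R :> R by rewrite ltr0n ffact_gt0.
have H1 : q / (i.+1%:R * (m ^_ i.+1)%:R) *+ (m - i) <= q / i.+1%:R / (m ^_ i)%:R.
  rewrite -mulr_natr ffactnSr natrM !invfM.
  have [->|E] := eqVneq ((m-i)%:R : R) 0; first by rewrite mulr0 !mulr_ge0 ?invr_ge0.
  by rewrite -!mulrA mulVf // mulr1.
(* Truncation at [N] only lowers the weight of the records. *)
have H2 : c / i.+1%:R * (i%:R^-1 * ((m ^_ i)%:R^-1 - (N ^_ i)%:R^-1))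
    <= c / i.+1%:R * (i%:R^-1 * (m ^_ i)%:R^-1).
  by rewrite !ler_wpM2l ?divr_ge0 ?invr_ge0 // gerBl invr_ge0.
apply: (le_trans (lerD H1 H2)).
rewrite /c -/q le_eqVlt; apply/orP; left; apply/eqP.
by field; rewrite !gt_eqF.
Qed.

End dynamic_programming.
End stopping.

(** * Winning weight and total weight of whole tuples *)

Section whole_tuples.
Variables (R : realType) (N : nat).
Implicit Types u t v : seq 'I_N.

(** The bound for a prefix divides by its length, so the first value, always a record, is treated
    apart; a first value [x] contributes at most [Q 0 / (x + 1)]. *)
Lemma sum_stops_on_top_nil_le n (Q : nat -> R) (e : seq 'I_N -> bool) :
  (forall i, 0 <= Q i) -> (forall i, (i < n.+1)%N -> Q i.+1 <= Q i) ->
  (forall u x, (size u < n.+1)%N -> e (rcons u x) ->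
    (size u)%:R * Q (size u).+1 + (size u).+1%:R
    <= (size u).+1%:R * Q (size u)) ->
  \sum_(v : n.+1.-tuple 'I_N) weight R v * (stops_on_top e [::] v)%:R
  <= Q 0 * \sum_(x < N) x.+1%:R^-1.
Proof.
move=> Q0 Qn Qs; rewrite big_tuple_cons mulr_sumr; apply: ler_sum => x _ /=.
have t1 : top [:: x] = x.+1 by rewrite /top big_seq1.
have x0 : 0 <= x.+1%:R^-1 :> R by rewrite invr_ge0.
case: (boolP (e [:: x])) => He.
  have := sum_weight_top_stable_le R n (u := [:: x]) isT.
  rewrite t1 /= ffactn1 => /le_trans; apply.
  have := Qs [::] x isT He; rewrite /= mul0r add0r mul1r => H.
  by rewrite ler_peMl.
have := sum_stops_on_top_le Q0 Qn Qs (k := n) (u := [:: x]) isT erefl isT.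
rewrite /= t1 ffactn1 mul1r => /le_trans; apply.
by rewrite ler_wpM2r // Qn.
Qed.

(** When the first value is the maximum, the number of choices for the other [k] cancels every
    factor of the falling factorial except [x + 1]; such choices exist only if [k <= x]. *)
Lemma sum_weight_head_top k :
  \sum_(v : k.+1.-tuple 'I_N) weight R v * (top v == (thead v).+1)%:R
  = \sum_(x < N | (k <= x)%N) x.+1%:R^-1.
Proof.
rewrite big_tuple_cons [RHS]big_mkcond; apply: eq_bigr => x _ /=.
have t1 : top [:: x] = x.+1 by rewrite /top big_seq1.
transitivity (\sum_(t : k.-tuple 'I_N) weight R ([:: x] ++ t) *
    (top ([:: x] ++ t) == top [:: x])%:R).
  by apply: eq_bigr => t _; rewrite theadE t1.
rewrite sum_weight_top_stable // t1 /= subSS subn0 add1n ffactSS natrM.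
case: leqP => kx; last by rewrite ffact_small ?mul0r.
by rewrite invfM mulrCA mulfV ?mulr1 // pnatr_eq0 -lt0n ffact_gt0.
Qed.

Lemma weight_perm u v : perm_eq u v -> weight R u = weight R v.
Proof.
move=> uv; rewrite /weight (perm_uniq uv) (perm_size uv).
by rewrite /top (perm_big _ uv).
Qed.

Lemma top_perm u v : perm_eq u v -> top u = top v.
Proof. by move=> uv; rewrite /top (perm_big _ uv). Qed.

(* Each position is equally likely to hold the maximum, by rotation. *)
Lemma sum_weight_ge k :
  k.+1%:R * (\sum_(x < N | (k <= x)%N) x.+1%:R^-1)
  <= \sum_(v : k.+1.-tuple 'I_N) weight R v.
Proof.
rewrite -sum_weight_head_top.
have -> : k.+1%:R * \sum_(v : k.+1.-tuple 'I_N) weight R v * (top v == (thead v).+1)%:R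
   = \sum_(l < k.+1) \sum_(v : k.+1.-tuple 'I_N)
       weight R v * (top v == (tnth v l).+1)%:R.
  rewrite mulr_natl -[X in _ *+ X](card_ord k.+1) -sumr_const.
  apply: eq_bigr => l _.
  rewrite (reindex (fun v : k.+1.-tuple 'I_N => [tuple of rot l v])) /=; last first.
    exists (fun v : k.+1.-tuple 'I_N => [tuple of rotr l v]) => v _; apply/val_inj => /=.
      exact: rotK.
    exact: rotrK.
  apply: eq_bigr => v _.
  rewrite (weight_perm (v := v)) ?perm_rot // (top_perm (v := v)) ?perm_rot //.
  congr (_ * (_ == _.+1)%:R).
  have [x0] : exists x0 : 'I_N, True by exists (tnth v l).
  rewrite /thead !(tnth_nth x0) /= /rot nth_cat size_drop size_tuple.
  by rewrite subn_gt0 ltn_ord nth_drop addn0.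
rewrite exchange_big /=; apply: ler_sum => v _; rewrite -mulr_sumr.
rewrite /weight; have [uv|] := boolP (uniq v); last by rewrite !mul0r.
rewrite ler_piMr ?divr_ge0 // -natr_sum -[1]/(1%:R) ler_nat.
(* Distinct values leave at most one position for the maximum. *)
have [l Hl|none] := pickP [pred l | top v == (tnth v l).+1]; last first.
  by rewrite big1 // => l _; have /= -> := none l.
rewrite (bigD1 l) //= big1 ?addn0 ?leq_b1 // => l' /negP ll'.
case: eqP => // E; case: ll'; apply/eqP; apply/(tuple_uniqP _ uv).
by apply/val_inj; move/eqP: Hl; rewrite /= E => - [].
Qed.

Lemma sum_perm_tuple n (F : n.-tuple 'I_N -> R) (tau : 'S_n) :
  \sum_(v : n.-tuple 'I_N) F [tuple tnth v (tau i) | i < n] = \sum_v F v.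
Proof.
rewrite [RHS](reindex (fun v : n.-tuple 'I_N => [tuple tnth v (tau i) | i < n])) //.
exists (fun v : n.-tuple 'I_N => [tuple tnth v (tau^-1%g i) | i < n]) => v _;
  by apply: eq_from_tnth => i; rewrite !tnth_mktuple ?permKV ?permK.
Qed.

End whole_tuples.

Lemma exists_harmonic_ge (R : realType) (M : R) :
  exists N, M <= \sum_(x < N) x.+1%:R^-1.
Proof.
have [//|H] := pselect (exists N, M <= \sum_(x < N) x.+1%:R^-1).
exfalso; apply: (@dvg_harmonic R); apply: nondecreasing_is_cvgn.
  apply: nondecreasing_series => i _ _; exact: harmonic_ge0.
exists M => _ [N _ <-]; rewrite leNgt; apply/negP => MN; apply: H; exists N.
by rewrite ltW // -(big_mkord xpredT (fun x => x.+1%:R^-1)).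
Qed.

(** * The threshold rule *)

Section threshold_rule.
Variables (R : realType) (n : nat).

Definition inv_sum (j : nat) : R := \sum_(j <= i < n) i%:R^-1.

Lemma inv_sum_ge0 j : 0 <= inv_sum j.
Proof. by rewrite /inv_sum sumr_ge0. Qed.

Lemma inv_sumS j : (j < n)%N -> inv_sum j = j%:R^-1 + inv_sum j.+1.
Proof. by move=> jn; rewrite /inv_sum big_ltn. Qed.

Lemma inv_sum_n : inv_sum n = 0.
Proof. by rewrite /inv_sum big_geq. Qed.

Lemma inv_sum_anti i j : (i <= j)%N -> inv_sum j <= inv_sum i.
Proof.
elim: j => [|j IH]; first by rewrite leqn0 => /eqP ->.
rewrite leq_eqVlt => /orP[/eqP ->//|]; rewrite ltnS => /IH; apply: le_trans.
have [jn|nj] := ltnP j n; first by rewrite (inv_sumS jn) lerDr.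
by rewrite /inv_sum big_geq ?inv_sum_ge0 // leqW.
Qed.

(** Exponential form of [inv_sum k.+1 <= ln ((n-1) / k)], by downward induction from
    [k * expR (1/(k+1)) <= k+1]. *)
Lemma expR_inv_sum_le k : (0 < k)%N -> (k < n)%N ->
  k%:R * expR (inv_sum k.+1) <= n.-1%:R.
Proof.
move=> k0 kn; have [d Ed] : exists d, n.-1 = (k + d)%N by exists (n.-1 - k)%N; lia.
elim: d k k0 kn Ed => [|d IH] k k0 kn Ed.
  by rewrite (_ : k.+1 = n) ?inv_sum_n ?expR0 ?mulr1 ?Ed ?addn0 //; lia.
rewrite inv_sumS; last by lia.
rewrite expRD mulrA; apply: le_trans (IH k.+1 _ _ _); [|lia..].
rewrite ler_pM2r ?expR_gt0 //.
have := @expR_ge1Dx R (- k.+1%:R^-1); rewrite expRN => H.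
have p : 0 < k.+1%:R :> R by rewrite ltr0n.
have q := expR_gt0 (k.+1%:R^-1 : R).
rewrite -ler_pdivlMr //.
apply: le_trans (ler_wpM2l (ltW p) H).
by rewrite mulrDr mulr1 mulrN mulfV ?gt_eqF // -natr1 addrK.
Qed.

(** The companion [ln (n / k) <= inv_sum k], from [k+1 <= k * expR (1/k)]. *)
Lemma expR_inv_sum_ge k : (0 < k)%N -> (k <= n)%N ->
  n%:R <= k%:R * expR (inv_sum k).
Proof.
move=> k0 kn; have [d Ed] : exists d, n = (k + d)%N by exists (n - k)%N; lia.
elim: d k k0 kn Ed => [|d IH] k k0 kn Ed.
  by rewrite (_ : k = n) ?inv_sum_n ?expR0 ?mulr1 //; lia.
rewrite inv_sumS; last by lia.
rewrite expRD mulrA; apply: (le_trans (IH k.+1 _ _ _)); [lia..|].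
rewrite ler_pM2r ?expR_gt0 //.
have := @expR_ge1Dx R (k%:R^-1).
have p : 0 < k%:R :> R by rewrite ltr0n.
move/(ler_wpM2l (ltW p)); apply: le_trans.
by rewrite mulrDr mulr1 mulfV ?gt_eqF // natr1.
Qed.

(* [threshold_value k j / n] is asymptotically the probability of picking the
   best of n items when the first j are skipped, with k ~ n / e. *)
Definition threshold_value (k j : nat) : R :=
  if (j < k)%N then k%:R else j%:R * inv_sum j.

Section fixed_threshold.
Variable k : nat.
Hypothesis k0 : (0 < k)%N.
Hypothesis inv_sum_k : inv_sum k <= 1.

Lemma threshold_value_ge0 j : 0 <= threshold_value k j.
Proof. by rewrite /threshold_value; case: ifP => // _; rewrite mulr_ge0 ?inv_sum_ge0. Qed.

(** An equality from [k] on. Strictly before, it amounts to [j + 1 <= k]; the crossing [j + 1 = k]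
    uses [inv_sum k <= 1]. *)
Lemma threshold_value_stop j : (j < n)%N ->
  j%:R * threshold_value k j.+1 + j.+1%:R <= j.+1%:R * threshold_value k j.
Proof.
rewrite /threshold_value => jn.
have p : 0 <= j%:R :> R by [].
have [jk|kj] := ltnP j k; last first.
  rewrite ltnNge leqW //= (inv_sumS jn).
  have j0 : j%:R != 0 :> R by rewrite pnatr_eq0; lia.
  rewrite le_eqVlt; apply/orP; left; apply/eqP.
  by field.
have [jk'|kj] := ltnP j.+1 k.
  by rewrite -(natr1 j) mulrDl mul1r lerD2l natr1 ler_nat ltnW.
have -> : k = j.+1 by lia.
have := inv_sum_k; rewrite (_ : k = j.+1); last lia.
rewrite -(natr1 j) => H.
have := ler_wpM2l (mulr_ge0 p (addr_ge0 p (@ler01 R))) H; nra.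
Qed.

(** From [k] on, the drop from [j] to [j + 1] is [1 - inv_sum j.+1], which is nonnegative as
    [inv_sum k <= 1]. *)
Lemma threshold_value_noninc j : (j < n)%N ->
  threshold_value k j.+1 <= threshold_value k j.
Proof.
rewrite /threshold_value => jn.
have p : 0 <= j%:R :> R by [].
have [jk|kj] := ltnP j k; last first.
  rewrite ltnNge leqW //= (inv_sumS jn).
  have j0 : j%:R != 0 :> R by rewrite pnatr_eq0; lia.
  rewrite mulrDr mulfV // -natr1 mulrDl mul1r addrC lerD2r.
  by apply: le_trans inv_sum_k; apply: inv_sum_anti; rewrite leqW.
have [jk'|kj] := ltnP j.+1 k => //.
have -> : k = j.+1 by lia.
have := inv_sum_k; rewrite (_ : k = j.+1); last lia.
by move=> H; rewrite ler_piMr.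
Qed.

(** Discrete form of the integral of [- x ln x], whose antiderivative is [x^2/4 - (x^2/2) ln x];
    downward induction on [j]. *)
Lemma sum_mul_inv_sum j : (0 < j)%N -> (j <= n)%N ->
  \sum_(j <= l < n.+1) l%:R * inv_sum l
  = (n%:R * n.+1%:R - j%:R * j.+1%:R) / 4 - j%:R * (j%:R - 1) / 2 * inv_sum j.
Proof.
move=> j0 jn; have [d Ed] : exists d, n = (j + d)%N by exists (n - j)%N; lia.
elim: d j j0 jn Ed => [|d IH] j j0 jn Ed.
  rewrite (_ : j = n); last lia.
  by rewrite big_nat1 inv_sum_n subrr mul0r !mulr0 subrr.
rewrite big_ltn; last by lia.
rewrite IH; [|lia..].
rewrite (inv_sumS (j := j)); last by lia.
have p : j%:R != 0 :> R by rewrite pnatr_eq0; lia.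
by rewrite -!(natr1 j.+1) -!(natr1 j); field.
Qed.

Lemma sum_threshold_value : (k <= n)%N ->
  \sum_(j < n.+1) threshold_value k j
  = k%:R ^+ 2 + (n%:R * n.+1%:R - k%:R * k.+1%:R) / 4
    - k%:R * (k%:R - 1) / 2 * inv_sum k.
Proof.
move=> kn; rewrite -(big_mkord xpredT) (@big_cat_nat _ _ _ k) //=; last by rewrite leqW.
rewrite -addrA -sum_mul_inv_sum //; congr (_ + _).
  rewrite (eq_big_nat _ _ (F2 := fun=> k%:R)); last first.
    by move=> i /andP[_ ik]; rewrite /threshold_value ik.
  by rewrite sumr_const_nat subn0 -[LHS]mulr_natr expr2.
by apply: eq_big_nat => i /andP[ki _]; rewrite /threshold_value ltnNge ki.
Qed.

End fixed_threshold.
End threshold_rule.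

Lemma expR1_le4 (R : realType) : expR 1 <= 4 :> R.
Proof.
have H := @expR_ge1Dx R (- 2^-1); rewrite expRN in H.
have p := expR_gt0 (2^-1 : R).
have -> : 1 = 2^-1 + 2^-1 :> R by field.
have : expR 2^-1 <= 2 :> R.
  have := ler_wpM2l (ltW p) H; rewrite mulfV ?gt_eqF //; lra.
rewrite expRD; nra.
Qed.

Lemma exists_threshold (R : realType) (n : nat) : (10 <= n)%N ->
  exists k, [/\ (0 < k)%N, inv_sum R n k <= 1 &
    \sum_(j < n.+1) threshold_value R n k j
    <= (1 / 4 + 1 / (4 * expR 1 ^+ 2)) * n%:R ^+ 2 + 40 * n%:R].
Proof.
move=> n10.
have e2 : 2 <= expR 1 :> R by have := @expR_ge1Dx R 1; rewrite -[1+1]/2%:R.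
have e3 := @expR1_le4 R.
set E := expR 1 in e2 e3 *.
have E0 : 0 < E by lra.
have n0 : 10 <= n%:R :> R by rewrite ler_nat.
have nE0 : 0 <= n%:R / E by rewrite divr_ge0 // ltW.
(* The offset 2 gives [k - 1 >= n / e], which forces [inv_sum k <= 1]. *)
pose k := (Num.truncn (n%:R / E)).+2.
have kE : k%:R <= n%:R / E + 2.
  by rewrite -[k]addn2 natrD lerD2r truncn_le.
have kE' : n%:R / E <= k.-1%:R.
  by rewrite ltW // truncnS_gt.
have kn : (k <= n)%N.
  rewrite -(ler_nat R); apply: le_trans kE _.
  have : n%:R / E <= n%:R / 2 by rewrite ler_wpM2l // lef_pV2 ?posrE.
  lra.
have k1 : 1 <= k%:R :> R by rewrite ler1n.
have Ak1 : inv_sum R n k <= 1.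
  rewrite -ler_expR -/E.
  have := @expR_inv_sum_le R n k.-1 isT kn; rewrite prednK // => H.
  have kp : 0 < k.-1%:R :> R by rewrite ltr0n.
  rewrite -(ler_pM2l kp); apply: le_trans H _.
  apply: (@le_trans _ _ n%:R); first by rewrite ler_nat leq_pred.
  by rewrite -ler_pdivrMr.
(* Apply [1 + t <= expR t] at [t = 1 - inv_sum k], where [expR t <= e * k / n <= 1 + 2 * e / n]. *)
have Ak2 : 1 - 2 * E / n%:R <= inv_sum R n k.
  have np : 0 < n%:R :> R by lra.
  have H := @expR_inv_sum_ge R n k isT kn.
  have H1 := @expR_ge1Dx R (1 - inv_sum R n k).
  rewrite expRD expRN -/E in H1.
  have ap := expR_gt0 (inv_sum R n k).
  have : E / expR (inv_sum R n k) <= E * k%:R / n%:R.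
    by rewrite ler_pdivrMr // mulrAC ler_pdivlMr // -mulrA ler_pM2l.
  have : E * k%:R / n%:R <= 1 + 2 * E / n%:R.
    rewrite ler_pdivrMr // mulrDl mul1r divfK ?gt_eqF //.
    have := ler_wpM2l (ltW E0) kE.
    rewrite [E * (_ + 2)]mulrDr [E * (_ / _)]mulrCA mulfV ?gt_eqF // mulr1; lra.
  lra.
exists k; split => //.
rewrite sum_threshold_value //.
set K := k%:R in kE k1 *; set m := n%:R in n0 kE nE0 Ak2 *; set A := inv_sum R n k in Ak1 Ak2 *.
have -> : n.+1%:R = m + 1 :> R by rewrite -natr1.
have -> : k.+1%:R = K + 1 :> R by rewrite -natr1.
have m0 : 0 < m by lra.
(* The leading part is [x^2 + (m^2 - x^2)/4 - x^2/2 = m^2/4 + x^2/4]; all other terms are linear in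
   [m], and 40 is a generous coefficient. *)
pose x := m / E; have Ex : m / E = x by [].
have -> : (1 / 4 + 1 / (4 * E ^+ 2)) * m ^+ 2 = m ^+ 2 / 4 + x ^+ 2 / 4.
  by rewrite /x; field; rewrite gt_eqF.
rewrite Ex in kE nE0.
have xm : x <= m / 2 by rewrite /x ler_wpM2l ?lef_pV2 ?posrE // ltW.
have KK : 0 <= K * (K - 1) / 2 by rewrite divr_ge0 // mulr_ge0; lra.
have H1 := ler_wpM2l KK Ak2.
have Km : K <= m by lra.
have H2 : K * (K - 1) / 2 * (2 * E / m) <= 4 * m.
  rewrite mulrA ler_pdivrMr //.
  have : K * (K - 1) <= m * m by nra.
  nra.
rewrite mulrBr mulr1 in H1.
have H3 : K ^+ 2 <= (x + 2) ^+ 2 by rewrite ler_pXn2r ?nnegrE //; lra.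
nra.
Qed.

(** * Trading against a deterministic rule *)

Lemma stops_on_topI (N : nat) (e : seq 'I_N -> bool) (u t : seq 'I_N) x0 i :
  (i < size t)%N -> e (u ++ take i.+1 t) ->
  (forall m, (0 < m)%N -> (m <= i)%N -> ~~ e (u ++ take m t)) ->
  top (u ++ t) = (nth x0 t i).+1 -> stops_on_top e u t.
Proof.
elim: t u i => [//|x t IH] u [|i] /= it He Hne Ht.
  by move: He; rewrite take0 cats1 => ->; rewrite Ht.
have /negPf -> : ~~ e (rcons u x) by have := Hne 1%N isT isT; rewrite /= take0 cats1.
apply: (IH _ i); rewrite ?cat_rcons //.
by move=> m m0 mi; rewrite cat_rcons; have := Hne m.+1 isT mi.
Qed.

Section model.
Variables (R : realType) (N B : nat).

Definition buyer_obs (x : 'I_N) : observation R := (false, (B ^ x.+1)%:R).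

Definition arrivals (j : nat) (v : seq 'I_N) : seq (observation R) :=
  map buyer_obs (take j v) ++ (true, 0) :: map buyer_obs (drop j v).

(* Whether the rule holds the item and wants to sell it to the last buyer of
   [u], the seller having arrived after the first [j] buyers. *)
Definition sells (rule : seq (observation R) -> bool) (j : nat)
    (u : seq 'I_N) : bool :=
  [&& (j < size u)%N, rule (take j.+1 (arrivals j u)) & rule (arrivals j u)].

Definition tuple_prices (n : nat) (y : n.-tuple 'I_N) : 'I_n.+1 -> R :=
  prices 0 (fun i => (B ^ (tnth y i).+1)%:R).

Lemma arrivals_take j m (v : seq 'I_N) : (j <= m)%N -> (m <= size v)%N ->
  arrivals j (take m v) = take m.+1 (arrivals j v).
Proof.
move=> jm mv; rewrite /arrivals take_cat size_map size_takel ?(leq_trans jm) //.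
rewrite ltnNge leqW //= subSn //= take_takel //; congr (_ ++ _ :: _).
by rewrite -map_take take_drop subnK.
Qed.

Section fixed_order.
Variables (n : nat) (y : n.-tuple 'I_N) (j : 'I_n.+1) (tau : 'S_n).
Let p := tuple_prices y.
Let s := lift_perm j ord0 tau.
Let v := [tuple tnth y (tau i) | i < n].

(** [lift_perm j ord0 tau] is the order in which the seller comes at time [j] and the buyers follow
    [tau]. *)
Lemma arrivals_lift_perm : [seq reveal p (s u) | u <- enum 'I_n.+1] = arrivals j v.
Proof.
have jn : (j <= n)%N by rewrite -ltnS.
apply: (@eq_from_nth _ (false, 0)) => [|i].
  rewrite size_map size_enum_ord /arrivals size_cat /= !size_map.
  by rewrite size_takel ?size_tuple ?card_ord // addnS subnKC.
rewrite size_map size_enum_ord => ni.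
rewrite (nth_map ord0) ?size_enum_ord //.
have -> : nth ord0 (enum 'I_n.+1) i = Ordinal ni by apply/val_inj; rewrite /= nth_enum_ord.
rewrite /arrivals nth_cat size_map size_takel ?size_tuple //.
case: (unliftP j (Ordinal ni)) => [i'|] E.
  rewrite E /s lift_perm_lift /reveal /p /tuple_prices /prices liftK.
  have -> : (lift ord0 (tau i') == ord0) = false by rewrite eq_sym (negPf (neq_lift _ _)).
  have Ei : i = bump j i' by rewrite -[LHS]/(val (Ordinal ni)) E.
  have Hn : nth (tnth y (tau i')) v i' = tnth y (tau i').
    by rewrite -tnth_nth tnth_mktuple.
  rewrite Ei /bump; case: (leqP j i') => ji'.
    rewrite add1n ltnNge leqW //= subSn //= (nth_map (tnth y (tau i'))); last first.
      rewrite size_drop size_tuple ?card_ord; apply: ltn_sub2r => //; apply: leq_ltn_trans ji' (ltn_ord i').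
    by rewrite nth_drop subnKC // [nth _ _ _]Hn.
  rewrite add0n ji' (nth_map (tnth y (tau i'))) ?nth_take ?Hn //.
  by rewrite size_takel // size_tuple.
have Ei : i = j by rewrite -[LHS]/(val (Ordinal ni)) E.
rewrite E Ei ltnn subnn /= /s lift_perm_id /reveal eqxx /p /tuple_prices /prices.
by rewrite unlift_none.
Qed.

Lemma history_lift_perm (t : 'I_n.+1) : history p s t = take t.+1 (arrivals j v).
Proof.
rewrite -arrivals_lift_perm -map_take /history; congr map.
have {1}-> : enum 'I_n.+1 = take t.+1 (enum 'I_n.+1) ++ drop t.+1 (enum 'I_n.+1).
  by rewrite cat_take_drop.
rewrite filter_cat (eq_in_filter (a2 := predT)) ?filter_predT; last first.
  move=> u /(nthP ord0)[i]; rewrite size_takel ?size_enum_ord // => it <-.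
  rewrite nth_take // nth_enum_ord //.
  exact: leq_trans it (ltn_ord t).
rewrite [X in _ ++ X](eq_in_filter (a2 := pred0)) ?filter_pred0 ?cats0 //.
move=> u /(nthP ord0)[i]; rewrite size_drop size_enum_ord => it <-.
rewrite nth_drop nth_enum_ord; last by lia.
by apply/negbTE; lia.
Qed.

(** A buyer can get the item only at the first prefix where [sells] holds, which turns trading into
    a stopping problem. *)
Lemma final_holder_lift_perm (rule : seq (observation R) -> bool) :
  if final_holder rule p s is Some a then
    a = ord0 \/ exists i : 'I_n, [/\ a = lift ord0 (tau i),
      sells rule j (take i.+1 v) &
      forall m, (m <= i)%N -> ~~ sells rule j (take m v)]
  else True.
Proof.
pose r k := rule (take k.+1 (arrivals j v)).
pose f h t := step (rule (history p s t)) h (s t).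
pose h k := foldl f (Some ord0) (take k (enum 'I_n.+1)).
(* Invariant after [k] arrivals, [r] being the decision by time. The buyer with index [i >= j]
   arrives at time [i + 1], one later because of the seller. *)
pose P k (o : option 'I_n.+1) := match o with
  | None => [/\ (j < k)%N, r j & forall i, (j < i)%N -> (i < k)%N -> ~~ r i]
  | Some a => a = ord0 \/ exists i : 'I_n, [/\ a = lift ord0 (tau i),
      (j <= i)%N, r j, r i.+1 & forall m, (j < m)%N -> (m <= i)%N -> ~~ r m]
  end.
have Ph k : (k <= n.+1)%N -> P k (h k).
  elim: k => [_|k IH kn]; first by rewrite /h take0 /=; left.
  have {IH} := IH (ltnW kn).
  have -> : h k.+1 = f (h k) (Ordinal kn).
    rewrite /h (take_nth ord0) ?size_enum_ord // foldl_rcons; congr (f _ _).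
    by apply/val_inj; rewrite /= nth_enum_ord.
  rewrite /f history_lift_perm -/(r k).
  case: (unliftP j (Ordinal kn)) => [i|] E.
    rewrite E /s lift_perm_lift /step.
    have -> : (lift ord0 (tau i) == ord0) = false by rewrite eq_sym (negPf (neq_lift _ _)).
    have Ek : k = bump j i by rewrite -[LHS]/(val (Ordinal kn)) E.
    case: (h k) => [a|] /=; first by case: ifP.
    case=> jk rj rn.
    have [ji Ek'] : (j <= i)%N /\ k = i.+1 by move: Ek jk; rewrite /bump; lia.
    case: (boolP (r k)) => rk /=.
      right; exists i; split => //; first by rewrite -Ek'.
      by move=> m jm mi; apply: rn => //; rewrite Ek'.
    split => //; first by lia.
    move=> m jm; rewrite ltnS leq_eqVlt => /orP[/eqP -> //|]; exact: rn.
  have Ek : k = j by rewrite -[LHS]/(val (Ordinal kn)) E.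
  rewrite E /s lift_perm_id /step eqxx /=.
  case: (h k) => [a|] /=; last by case; rewrite Ek ltnn.
  case: (boolP (r k)) => rk //=.
  case: eqP => [_ _|//]; split => //; first by rewrite Ek.
    by rewrite -Ek.
  by move=> m; rewrite Ek; lia.
have := Ph n.+1 (leqnn _); rewrite /h take_oversize ?size_enum_ord //.
rewrite /final_holder -/f; case: (foldl _ _ _) => [a|//] /= [->|]; first by left.
case=> i [-> ji rj ri rm]; right; exists i.
have sv : size v = n by rewrite size_tuple ?card_ord.
have Hs m : (j < m)%N -> (m <= n)%N -> sells rule j (take m v) = r m.
  move=> jm mn; rewrite /sells size_takel ?sv // jm /=.
  rewrite arrivals_take ?sv ?(ltnW jm) //.
  by rewrite take_takel ?ltnS 1?ltnW // -/(r j) rj.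
split => //; first by rewrite Hs // ltnS.
move=> m mi; have [mj|jm] := leqP m j.
  rewrite /sells size_takel ?sv; last by apply: leq_trans mi _; exact: ltnW.
  by rewrite ltnNge mj.
rewrite Hs //; first exact: rm.
by apply: leq_trans mi _; exact: ltnW.
Qed.

(** Prices are powers of [B], so any buyer other than the best is worth at most a fraction [1 / B]
    of the optimum. *)
Lemma welfare_lift_perm_le (rule : seq (observation R) -> bool) : (0 < B)%N ->
  welfare rule p s
  <= (B ^ top v)%:R * ((stops_on_top (sells rule j) [::] v)%:R + B%:R^-1).
Proof.
move=> B0; have rhs0 :
    0 <= (B ^ top v)%:R * ((stops_on_top (sells rule j) [::] v)%:R + B%:R^-1) :> R.
  by rewrite mulr_ge0 // addr_ge0 // invr_ge0.
have := final_holder_lift_perm rule; rewrite /welfare.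
case: (final_holder rule p s) => [a|//] [->|[i [-> ri rm]]].
  by rewrite /p /tuple_prices /prices unlift_none.
rewrite /p /tuple_prices /prices liftK.
have vi : nth (tnth y (tau i)) v i = tnth y (tau i) by rewrite -tnth_nth tnth_mktuple.
have lt_top : (tnth y (tau i) < top v)%N.
  by apply: leq_top; rewrite -vi mem_nth // size_tuple.
have [E|E] := eqVneq (tnth y (tau i)).+1 (top v).
  rewrite E; have -> : stops_on_top (sells rule j) [::] v.
    apply: (@stops_on_topI _ _ _ _ (tnth y (tau i)) i); rewrite ?size_tuple //=.
      by move=> m _; exact: rm.
    by rewrite vi E.
  by rewrite ler_peMr // lerDl invr_ge0.
apply: (@le_trans _ _ ((B ^ top v)%:R * B%:R^-1)); last first.
  by rewrite ler_wpM2l // lerDr.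
have topS : top v = (top v).-1.+1 by rewrite prednK // (leq_trans _ lt_top).
apply: (@le_trans _ _ (B ^ (top v).-1)%:R).
  by rewrite ler_nat leq_pexp2l //; lia.
by rewrite {2}topS expnSr natrM mulfK // pnatr_eq0 -lt0n.
Qed.

End fixed_order.
End model.

Lemma sum_lift_perm (R : nmodType) (n : nat) (F : 'S_n.+1 -> R) :
  \sum_s F s = \sum_(j < n.+1) \sum_(tau : 'S_n) F (lift_perm j ord0 tau).
Proof.
rewrite pair_big /= (reindex (fun z : 'I_n.+1 * 'S_n => lift_perm z.1 ord0 z.2)) //.
apply/onW_bij/inj_card_bij => [[j s] [j' s'] /= E|].
  have jj' : j = j'.
    by apply: (@perm_inj _ (lift_perm j ord0 s)); rewrite {2}E !lift_perm_id.
  congr pair => //; apply/permP => i; apply: (@lift_inj _ (ord0 : 'I_n.+1)).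
  by rewrite -(lift_perm_lift j) E -jj' lift_perm_lift.
by rewrite card_prod card_ord !card_Sn factS.
Qed.

(** * Averaging a deterministic rule over the weighted price vectors *)

Section fixed_rule.
Variables (R : realType) (N B n k : nat) (rule : seq (observation R) -> bool).
Hypothesis B0 : (0 < B)%N.
Hypothesis k0 : (0 < k)%N.
Hypothesis inv_sum_k : inv_sum R n.+1 k <= 1.

Lemma sum_stops_sells_le (j : nat) :
  \sum_(v : n.+1.-tuple 'I_N)
    weight R v * (stops_on_top (sells B rule j) [::] v)%:R
  <= threshold_value R n.+1 k j * \sum_(x < N) x.+1%:R^-1.
Proof.
(* No sale is possible among the first [j] buyers, so the value is frozen there and [Q_stop] is
   required only from length [j] on. *)
pose Q i := threshold_value R n.+1 k (maxn i j).
have -> : threshold_value R n.+1 k j = Q 0 by rewrite /Q max0n.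
apply: sum_stops_on_top_nil_le => [i|i ni|u x un /and3P[]].
- exact: threshold_value_ge0.
- rewrite /Q; have [ij|ji] := ltnP i j; first by rewrite !(maxn_idPr _) // ltnW.
  by rewrite (maxn_idPl (leqW ji)) threshold_value_noninc.
rewrite size_rcons ltnS => ju _ _.
by rewrite /Q (maxn_idPl ju) (maxn_idPl (leqW ju)) threshold_value_stop.
Qed.

(** Dividing by [B ^ top y] normalises the optimum to 1. Weights are invariant under permutation, so
    reindexing by [tau] reduces to buyers arriving in list order. *)
Lemma sum_welfare_lift_perm_le (j : 'I_n.+2) (tau : 'S_n.+1) :
  \sum_(y : n.+1.-tuple 'I_N) weight R y / (B ^ top y)%:R *
    welfare rule (tuple_prices R B y) (lift_perm j ord0 tau)
  <= threshold_value R n.+1 k j * \sum_(x < N) x.+1%:R^-1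
     + (\sum_(y : n.+1.-tuple 'I_N) weight R y) / B%:R.
Proof.
pose F (v : n.+1.-tuple 'I_N) :=
  weight R v * ((stops_on_top (sells B rule j) [::] v)%:R + B%:R^-1).
apply: (@le_trans _ _ (\sum_v F v)); last first.
  rewrite /F; under eq_bigr do rewrite mulrDr.
  by rewrite big_split /= -mulr_suml lerD2r sum_stops_sells_le.
rewrite -(sum_perm_tuple F tau); apply: ler_sum => y _.
pose v := [tuple tnth y (tau i) | i < n.+1]; have vy : perm_eq v y by apply/tuple_permP; exists tau.
rewrite -(weight_perm R vy) -(top_perm vy) /F -/v -mulrA ler_wpM2l ?weight_ge0 //.
rewrite mulrC ler_pdivrMr; last by rewrite ltr0n expn_gt0 B0.
by rewrite mulrC; exact: welfare_lift_perm_le.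
Qed.

Lemma sum_welfare_le :
  \sum_(y : n.+1.-tuple 'I_N) weight R y / (B ^ top y)%:R *
    ((\sum_s welfare rule (tuple_prices R B y) s) / (n.+2)`!%:R)
  <= (\sum_(j < n.+2) threshold_value R n.+1 k j) / n.+2%:R
       * \sum_(x < N) x.+1%:R^-1
     + (\sum_(y : n.+1.-tuple 'I_N) weight R y) / B%:R.
Proof.
set H := \sum_(x < N) _; set T := \sum_(y : n.+1.-tuple 'I_N) weight R y.
have f0 : 0 < (n.+2)`!%:R :> R by rewrite ltr0n fact_gt0.
under eq_bigr do rewrite mulrA mulr_sumr.
rewrite -mulr_suml exchange_big /= sum_lift_perm ler_pdivrMr //.
apply: (@le_trans _ _ (\sum_(j < n.+2) \sum_(tau : 'S_n.+1)
    (threshold_value R n.+1 k j * H + T / B%:R))).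
  by apply: ler_sum => j _; apply: ler_sum => tau _; exact: sum_welfare_lift_perm_le.
have cS (c : R) : \sum_(tau : 'S_n.+1) c = c *+ (n.+1)`!.
  by rewrite sumr_const; congr (_ *+ _); exact: card_Sn.
rewrite (eq_bigr (fun j : 'I_n.+2 =>
  (threshold_value R n.+1 k j * H + T / B%:R) *+ (n.+1)`!)) => [|j _]; last exact: cS.
rewrite sumrMnl big_split /= sumr_const card_ord -mulr_suml -mulr_natr.
rewrite factS natrM -(mulr_natr _ n.+2).
set P := \sum_(j < _) _.
rewrite le_eqVlt; apply/orP; left; apply/eqP; field.
by rewrite pnatr_eq0 -lt0n B0 /= -natrD pnatr_eq0.
Qed.

End fixed_rule.

(** * Randomized algorithms *)

Section algorithms.
Variables (R : realType) (A : online_algorithm R).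

(** [G] reads the rule only at the finitely many histories in [hs]. Fixing the decision at one of
    them splits the seed space into two measurable pieces, on each of which one history fewer is
    read. *)
Lemma measurable_decide_functional (G : (seq (observation R) -> bool) -> R)
    (hs : seq (seq (observation R))) :
  (forall r1 r2, all (fun h => r1 h == r2 h) hs -> G r1 = G r2) ->
  measurable_fun setT (fun w : seed A => G (decide w)).
Proof.
elim: hs G => [|h hs IH] G GE.
  have -> : (fun w : seed A => G (decide w)) = cst (G (fun=> false)).
    by apply/funext => w; exact: GE.
  exact: measurable_cst.
pose upd (r : seq (observation R) -> bool) b (h' : seq (observation R)) :=
  if (h' : seq (bool * R)) == h then b else r h'.
have Gupd w : G (decide w) =
    if decide w h then G (upd (@decide _ A w) true) else G (upd (@decide _ A w) false).
  have -> : (if @decide _ A w h then G (upd (@decide _ A w) true)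
             else G (upd (@decide _ A w) false)) = G (upd (@decide _ A w) (decide w h)).
    by case: (decide w h).
  by apply: GE; apply/allP => h' _; rewrite /upd; have [->|//] := eqVneq (h' : seq (bool * R)) h.
have Gb b : measurable_fun setT (fun w : seed A => G (upd (@decide _ A w) b)).
  apply: (IH (fun r => G (upd r b))) => r1 r2 r12; apply: GE.
  rewrite /= {1 2}/upd !eqxx /=; apply/allP => h' h'hs; rewrite /upd.
  by have [//|_] := eqVneq (h' : seq (bool * R)) h; exact: (allP r12).
have -> : (fun w : seed A => G (decide w)) = (fun w =>
    if decide w h then G (upd (@decide _ A w) true)
    else G (upd (@decide _ A w) false)) by apply/funext.
apply: measurable_fun_ifT => //; apply: (measurable_fun_bool true).
rewrite setTI; exact: measurable_decide.
Qed.

Section fixed_prices.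
Variables (n : nat) (p : 'I_n.+1 -> R).

Lemma eq_welfare (r1 r2 : seq (observation R) -> bool) s :
  all (fun h => r1 h == r2 h) [seq history p s t | t <- enum 'I_n.+1] ->
  welfare r1 p s = welfare r2 p s.
Proof.
move=> r12; suff E : final_holder r1 p s = final_holder r2 p s by rewrite /welfare E.
rewrite /final_holder; elim: (enum _) (Some ord0) r12 => //= t ts IH h.
by case/andP => /eqP -> /IH ->.
Qed.

Definition mean_welfare (r : seq (observation R) -> bool) : R :=
  (\sum_s welfare r p s) / (n.+1)`!%:R.

Lemma measurable_mean_welfare :
  measurable_fun setT (fun w : seed A => mean_welfare (decide w)).
Proof.
apply: (measurable_decide_functional (hs :=
  flatten [seq [seq history p s t | t <- enum 'I_n.+1] | s <- enum 'S_n.+1])).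
move=> r1 r2 /allP r12; rewrite /mean_welfare; congr (_ / _).
apply: eq_bigr => s _; apply/eq_welfare/allP => h hs; apply/r12/flattenP.
exists [seq history p s t | t <- enum 'I_n.+1] => //.
by apply/mapP; exists s; rewrite ?mem_enum.
Qed.

Hypothesis p_ge0 : forall a, 0 <= p a.

Lemma mean_welfare_ge0 r : 0 <= mean_welfare r.
Proof.
rewrite /mean_welfare divr_ge0 // sumr_ge0 // => s _.
by rewrite /welfare; case: (final_holder _ _ _).
Qed.

Lemma ALG_ge0 : (0 <= ALG A p)%E.
Proof.
rewrite /ALG expectation.unlock; apply: integral_ge0 => w _.
by rewrite lee_fin mean_welfare_ge0.
Qed.

End fixed_prices.

(** Buyers' identities are not revealed, so renaming buyers only changes the arrival order. This
    later allows sorting the prices. *)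
Lemma welfare_relabel n (p : 'I_n.+1 -> R) (rule : seq (observation R) -> bool)
    (sigma s : 'S_n.+1) : sigma ord0 = ord0 ->
  welfare rule (fun a => p (sigma a)) s = welfare rule p (s * sigma)%g.
Proof.
move=> s0; have sE a : (sigma a == ord0) = (a == ord0).
  by rewrite -{1}s0 (inj_eq perm_inj).
have hE t : history (fun a => p (sigma a)) s t = history p (s * sigma)%g t.
  by apply: eq_map => u; rewrite /reveal permM sE.
suff E : final_holder rule p (s * sigma)%g =
    omap sigma (final_holder rule (fun a => p (sigma a)) s).
  by rewrite /welfare E; case: (final_holder _ _ _).
rewrite /final_holder -{1}s0 -[Some (sigma ord0)]/(omap sigma (Some ord0)).
elim: (enum _) (Some ord0) => //= t ts IH h; rewrite -IH; congr (foldl _ _ _).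
rewrite -hE permM /step sE; case: (rule _) => //=.
have -> : (omap sigma h == Some ord0) = (h == Some ord0).
  by case: h => //= b; rewrite !(inj_eq (@Some_inj _)) sE.
have -> : (omap sigma h == None) = (h == None) by case: h.
by case: ifP => // _; case: ifP.
Qed.

Lemma ALG_relabel n (p : 'I_n.+1 -> R) (sigma : 'S_n.+1) : sigma ord0 = ord0 ->
  ALG A (fun a => p (sigma a)) = ALG A p.
Proof.
move=> s0; rewrite /ALG; congr expectation; apply/funext => w; congr (_ / _).
under eq_bigr do rewrite welfare_relabel //.
rewrite [RHS](reindex (fun s => s * sigma)%g) //.
by exists (fun s => s * sigma^-1)%g => s _; rewrite ?mulgK ?mulgKV.
Qed.

(** Yao's principle: if [ALG] exceeded [b i] wherever [q i > 0], integrating the bound [M] over the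
    seed would contradict [M < \sum_i q i * b i]. *)
Lemma exists_ALG_le (I : finType) (n : nat) (p : I -> 'I_n.+1 -> R)
    (q b : I -> R) (M : R) :
  (forall i a, 0 <= p i a) -> (forall i, 0 <= q i) ->
  (forall w : seed A, \sum_i q i * mean_welfare (p i) (decide w) <= M) ->
  M < \sum_i q i * b i -> exists2 i, 0 < q i & (ALG A (p i) <= (b i)%:E)%E.
Proof.
move=> p0 q0 HM Mb; apply: contrapT => Hn.
have H i : ((q i)%:E * (b i)%:E <= (q i)%:E * ALG A (p i))%E.
  have [->|qi] := eqVneq (q i) 0; first by rewrite !mul0e.
  have qi0 : 0 < q i by rewrite lt_def qi q0.
  rewrite lee_pmul2l // ?lte_fin // leNgt; apply/negP => /ltW le.
  by apply: Hn; exists i.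
have : (\sum_i (q i * b i)%:E <= \sum_i (q i)%:E * ALG A (p i))%E.
  by apply: lee_sum => i _; rewrite EFinM.
rewrite leNgt => /negP; apply.
apply: (@le_lt_trans _ _ M%:E); last by rewrite sumEFin lte_fin.
pose f i (w : seed A) : \bar R := ((q i)%:E * (mean_welfare (p i) (decide w))%:E)%E.
have mf i : measurable_fun setT (EFin \o (fun w : seed A => mean_welfare (p i) (decide w))).
  by apply/measurable_EFinP; exact: measurable_mean_welfare.
have m0 i w : (0 <= (mean_welfare (p i) (@decide _ A w))%:E)%E.
  by rewrite lee_fin mean_welfare_ge0.
have f0 i w : (0 <= f i w)%E by rewrite mule_ge0 // lee_fin.
have mqf i : measurable_fun setT (f i) by apply: measurable_funeM; exact: mf.
have -> : (\sum_i (q i)%:E * ALG A (p i) = \int[seed_law A]_w \sum_i f i w)%E.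
  rewrite ge0_integral_sum //; apply: eq_bigr => i _.
  rewrite (ge0_integralZl_EFin (seed_law A) measurableT (fun w _ => m0 i w) (mf i) (q0 i)).
  by rewrite /ALG expectation.unlock.
have -> : M%:E = (\int[seed_law A]_w cst M%:E w)%E.
  rewrite integral_cst // -[LHS]mule1; congr (_ * _)%E.
  exact/esym/probability_setT.
apply: ge0_le_integral => //.
- by move=> w _; apply: sume_ge0.
- by apply: emeasurable_sum.
move=> w _; rewrite /f; under eq_bigr do rewrite -EFinM.
by rewrite sumEFin lee_fin HM.
Qed.

End algorithms.

(** * Hard price vectors and the choice of parameters *)

Lemma tuple_prices_ge0 (R : realType) (N B n : nat) (y : n.-tuple 'I_N) a :
  0 <= tuple_prices R B y a.
Proof. by rewrite /tuple_prices /prices; case: unlift. Qed.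

Lemma exists_tuple_ALG_le (R : realType) (A : online_algorithm R)
    (N B n k : nat) (c : R) :
  (0 < B)%N -> (0 < k)%N -> inv_sum R n.+1 k <= 1 ->
  (\sum_(j < n.+2) threshold_value R n.+1 k j) / n.+2%:R
      * \sum_(x < N) x.+1%:R^-1
    + (\sum_(y : n.+1.-tuple 'I_N) weight R y) / B%:R
  < c * \sum_(y : n.+1.-tuple 'I_N) weight R y ->
  exists2 y : n.+1.-tuple 'I_N, uniq y &
    (ALG A (tuple_prices R B y) <= (c * (B ^ top y)%:R)%:E)%E.
Proof.
move=> B0 k0 Ak H.
have Bp (y : n.+1.-tuple 'I_N) : 0 < (B ^ top y)%:R :> R by rewrite ltr0n expn_gt0 B0.
set M := (X in X < _) in H.
have [||||y wy Hy] := @exists_ALG_le R A _ _ (fun y : n.+1.-tuple 'I_N => tuple_prices R B y)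
  (fun y => weight R y / (B ^ top y)%:R) (fun y => c * (B ^ top y)%:R) M.
- exact: tuple_prices_ge0.
- by move=> y; rewrite divr_ge0 ?weight_ge0.
- move=> w; apply: sum_welfare_le B0 k0 Ak.
- rewrite mulr_sumr in H; apply: lt_le_trans H _; apply: ler_sum => y _.
  by rewrite [X in _ <= X]mulrCA divfK ?gt_eqF.
exists y => //.
by move: wy; rewrite /weight; case: uniq; rewrite // !mul0r ltxx.
Qed.

Lemma exists_decreasing_perm (N n : nat) (y : n.-tuple 'I_N) : uniq y ->
  exists s : 'S_n, forall i j : 'I_n, (i < j)%N -> (tnth y (s j) < tnth y (s i))%N.
Proof.
move=> uy; pose ge (a b : 'I_N) := (b <= a)%N.
have : perm_eq (sort ge y) y by rewrite perm_sort.
case/tuple_permP => s Es; exists s => i j ij.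
have ge_tr : transitive ge by move=> a b d ba ad; exact: leq_trans ad ba.
have := sort_sorted (fun a b : 'I_N => leq_total b a) y; rewrite -/ge Es => Hs.
pose x0 := tnth y i.
have := sorted_leq_nth ge_tr (fun a => leqnn a) x0 Hs.
move=> /(_ i j); rewrite !inE size_tuple !ltn_ord => /(_ isT isT (ltnW ij)).
have En (l : 'I_n) : nth x0 [tuple tnth y (s i) | i < n] l = tnth y (s l).
  by rewrite -tnth_nth tnth_mktuple.
rewrite !En /ge leq_eqVlt => /orP[/eqP /val_inj E|//].
have /perm_inj ji := (tuple_uniqP _ uy) _ _ E.
by rewrite ji ltnn in ij.
Qed.

Lemma OPT_ge (R : realType) (n : nat) (p : 'I_n.+1 -> R) a : p a <= OPT p.
Proof. exact: le_bigmax. Qed.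

Lemma exists_prices_ALG_le (R : realType) (eta : R) : 0 < eta ->
  exists n0 : nat, forall (A : online_algorithm R) n, (n0 <= n)%N ->
    exists X : 'I_n -> nat,
      (forall i j : 'I_n, (i < j)%N -> (X j < X i)%N) /\
      let p : 'I_n.+1 -> R := prices 0 (fun i => (X i)%:R) in
      (0 < OPT p) /\
      (ALG A p <= ((1 / 4 + 1 / (4 * expR 1 ^+ 2) + eta) * OPT p)%:E)%E.
Proof.
move=> eta0; set kappa := 1 / 4 + _.
have kappa0 : 0 < kappa.
  by rewrite /kappa addr_gt0 // divr_gt0 // mulr_gt0 // exprn_gt0 // expR_gt0.
(* [eta] is split into three: the linear error of the threshold rule (large [n]), the sales to other
   buyers (large [B]), and the truncation (large [N]). *)
pose n1 := Num.truncn (40 / (eta / 3)); exists (n1 + 10)%N => A n nn.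
have [n' En] : exists n', n = n'.+1 by exists n.-1; lia.
have n10 : (9 < n)%N by lia.
have [k [k0 Ak SP]] := @exists_threshold R n n10.
clear n10; subst n; set n := n'.+1 in nn Ak SP *.
have np : 0 < n%:R :> R by rewrite ltr0n.
have en : 40 / n%:R <= eta / 3.
  rewrite ler_pdivrMr // mulrC -ler_pdivrMr; last by rewrite divr_gt0.
  rewrite ltW // (lt_le_trans (truncnS_gt _)) // ler_nat; apply: leq_trans nn.
  by rewrite /n1 addnS ltnS leq_addr.
pose S := kappa + eta / 3.
have S0 : 0 < S by rewrite addr_gt0 // divr_gt0.
have SPS : (\sum_(j < n.+1) threshold_value R n k j) / n.+1%:R <= S * n%:R.
  rewrite ler_pdivrMr ?ltr0n //; apply: le_trans SP _.
  have : 40 * n%:R <= eta / 3 * n%:R ^+ 2.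
    by rewrite expr2 mulrA ler_pM2r // -ler_pdivrMr.
  rewrite -natr1 /S -/kappa => H.
  have : 0 <= kappa * n%:R by rewrite mulr_ge0 // ltW.
  have : 0 <= eta / 3 * n%:R by rewrite mulr_ge0 // divr_ge0 // ltW.
  lra.
pose B := (Num.truncn (3 / eta)).+2.
have B0 : 0 < B%:R :> R by rewrite ltr0n.
have eB : B%:R^-1 < eta / 3.
  rewrite -[eta / 3]invf_div ltf_pV2 ?posrE ?divr_gt0 //.
  by apply: lt_le_trans (truncnS_gt _) _; rewrite ler_nat.
pose h : R := \sum_(x < n') x.+1%:R^-1.
have h0 : 0 <= h by apply: sumr_ge0 => x _; rewrite invr_ge0.
(* The total weight misses the first [n'] harmonic terms, of sum [h]. The summand [h + 1] makes the
   tail [T] positive; the last summand makes [(S + eta / 3) * h] at most [eta / 3] times the whole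
   sum. *)
have [N HN] := @exists_harmonic_ge R (h + 1 + (S + eta / 3) * h * (3 / eta)).
set Hh := \sum_(x < N) _ in HN.
have SE : 0 <= S + eta / 3 by lra.
have q0 : 0 <= (S + eta / 3) * h * (3 / eta).
    apply: mulr_ge0; [exact: mulr_ge0 | by rewrite divr_ge0 // ltW].
have N_split : Hh <= h + \sum_(x < N | (n' <= x)%N) x.+1%:R^-1.
  have [nN|Nn] := leqP n' N; last first.
    apply: (@le_trans _ _ h); last by rewrite lerDl sumr_ge0 // => x _; rewrite invr_ge0.
    by rewrite /Hh /h !(big_ord_widen _ (fun x => x.+1%:R^-1) (ltnW Nn)) big_mkcond;
      apply: ler_sum => x _; case: ifP => // _; rewrite invr_ge0.
  rewrite /Hh (bigID (fun x : 'I_N => (x < n')%N)) /=.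
  rewrite (big_ord_narrow nN) /= lerD2l.
  by under eq_bigl do rewrite -leqNgt.
set T := \sum_(x < N | _) _ in N_split.
have Tpos : 0 < T by lra.
have TT := @sum_weight_ge R N n'; rewrite -/n -/T in TT.
set W := \sum_v _ in TT.
have W0 : 0 < W by apply: lt_le_trans TT; rewrite mulr_gt0.
have key : S * Hh <= (S + eta / 3) * T.
  have H1 : (S + eta / 3) * h <= eta / 3 * Hh.
    have -> : (S + eta / 3) * h = eta / 3 * ((S + eta / 3) * h * (3 / eta)).
      by field; rewrite gt_eqF.
    by rewrite ler_pM2l ?divr_gt0 //; lra.
  have H2 : (S + eta / 3) * Hh <= (S + eta / 3) * (h + T).
    by rewrite ler_wpM2l.
  nra.
have [||||y uy Hy] := @exists_tuple_ALG_le R A N B n' k (kappa + eta) => //.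
  rewrite -/n -/Hh -/W.
  have H1 : (\sum_(j < n.+1) threshold_value R n k j) / n.+1%:R * Hh
      <= (S + eta / 3) * W.
    apply: (@le_trans _ _ (S * n%:R * Hh)).
      by rewrite ler_wpM2r //; lra.
    apply: (@le_trans _ _ ((S + eta / 3) * (n%:R * T))).
      by rewrite [X in X <= _]mulrAC [X in X <= _]mulrC [X in _ <= X]mulrCA ler_pM2l.
    by rewrite ler_wpM2l.
  have H2 : W / B%:R < eta / 3 * W by rewrite mulrC ltr_pM2r.
  have H3 : (S + eta / 3) * W + W / B%:R < (kappa + eta) * W by rewrite /S; lra.
  by apply: le_lt_trans H3; rewrite lerD2r.
(* The tuple found need not be sorted; [ALG_relabel] lets the buyers be renamed in decreasing order
   of price. *)
have [s sP] := exists_decreasing_perm uy.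
exists (fun i => (B ^ (tnth y (s i)).+1)%N); split.
  by move=> i j ij; rewrite ltn_exp2l // ltnS; exact: sP.
move=> p.
have Ep : p = (fun a => tuple_prices R B y (lift_perm ord0 ord0 s a)).
  apply/funext => a; rewrite /p /tuple_prices /prices.
  case: (unliftP ord0 a) => [i|] ->; rewrite ?lift_perm_lift ?liftK //.
  by rewrite lift_perm_id unlift_none.
have [x xy topx] : exists2 x, x \in (y : seq _) & top y = x.+1.
  by apply: top_attained; rewrite size_tuple.
have [l El] : exists l, tnth y l = x by case/tnthP: xy => l ->; exists l.
have Bx : (B ^ top y)%:R <= OPT p.
  have := OPT_ge p (lift ord0 ((s^-1)%g l)).
  by rewrite {1}Ep lift_perm_lift permKV /tuple_prices /prices liftK El -topx.
have Bt : 0 < (B ^ top y)%:R :> R by rewrite ltr0n expn_gt0.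
split; first exact: lt_le_trans Bx.
rewrite Ep ALG_relabel ?lift_perm_id // -Ep; apply: le_trans Hy _.
by rewrite lee_fin ler_wpM2l // addr_ge0 // ltW.
Qed.

(* The quotient is taken in \bar R, where x / 0 = +oo for every x > 0. *)
Theorem theorem3p6 (R : realType) (alg : nat -> online_algorithm R)
    (delta : R) (hdelta : 0 < delta) :
  exists n0 : nat, forall n : nat, (n0 <= n)%N ->
    exists X : 'I_n -> nat,
      (forall i j : 'I_n, (i < j)%N -> (X j < X i)%N) /\
      let p : 'I_n.+1 -> R := prices 0 (fun i => (X i)%:R) in
      ((4 * expR 1 ^+ 2 / (expR 1 ^+ 2 + 1) - delta)%:E
         <= (OPT p)%:E / ALG (alg n) p)%E.
Proof.
set K := 4 * _ / _; set kappa : R := 1 / 4 + 1 / (4 * expR 1 ^+ 2).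
have e0 := expR_gt0 (1 : R).
have Kk : K * kappa = 1.
  have : 0 < expR 1 ^+ 2 + 1 :> R by rewrite addr_gt0 // exprn_gt0.
  by rewrite /K /kappa => H; field; rewrite !gt_eqF // addrC.
have kappa0 : 0 < kappa.
  by rewrite /kappa addr_gt0 // divr_gt0 // mulr_gt0 // exprn_gt0.
have K0 : 0 < K by rewrite -(pmulr_lgt0 _ kappa0) Kk.
(* Chosen so that [K * eta = delta * kappa], whence [(K - delta) * (kappa + eta) = 1 - delta *
   eta]. *)
pose eta := delta * kappa / K.
have eta0 : 0 < eta by rewrite divr_gt0 // mulr_gt0.
have [n0 Hn0] := exists_prices_ALG_le eta0; exists n0 => n nn.
have [X [Xdec [OPT0 ALGle]]] := Hn0 (alg n) n nn.
exists X; split => // p; rewrite -/p -/kappa in OPT0 ALGle.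
have p0 a : 0 <= p a by rewrite /p /prices; case: unlift.
have ALG0 := ALG_ge0 (alg n) p0.
have Hratio : (K - delta) * (kappa + eta) <= 1.
  have E : K * eta = delta * kappa by rewrite /eta mulrC divfK // gt_eqF.
  have : 0 <= delta * eta by rewrite mulr_ge0 // ltW.
  have -> : (K - delta) * (kappa + eta) = K * kappa + K * eta - delta * kappa - delta * eta.
    by move: (kappa) (eta) => x y; ring.
  by rewrite Kk E; lra.
case: (ALG (alg n) p) ALG0 ALGle => [r| |] //; rewrite !lee_fin => r0 rle.
have [->|rn0] := eqVneq r 0.
  by rewrite inve0 gt0_muley ?lte_fin // leey.
have rp : 0 < r by rewrite lt_def rn0.
rewrite inver (negPf rn0) -EFinM lee_fin ler_pdivlMr //.
(* For large [delta] the claimed ratio is not positive and the bound is immediate. *)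
have [Kd|Kd] := leP (K - delta) 0.
  by apply: le_trans (ltW OPT0); rewrite mulr_le0_ge0.
apply: le_trans (ler_wpM2l (ltW Kd) rle) _.
by rewrite mulrA ler_piMl // ltW.
Qed.
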